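(* Let $f:\mathbb R\to\mathbb R$ be a smooth, odd, $2\pi$-periodic function, and let $\delta=(E,f)$ be the perturbation data on $(S^2\times I,\{a,b,c,d\}\times I)$, $I=[0,1]$, described in the context. Then the map $$P\to R_\delta(S^2\times I,\{a,b,c,d\}\times I)$$ induced by the inclusion $S^2\times\{0\}\to S^2\times I$ is a homeomorphism, and the composite $$P\to R_\delta(S^2\times I,\{a,b,c,d\}\times I)\to R(S^2\times\{0,1\},\{a,b,c,d\}\times\{0,1\})=P\times P$$ is the graph of the self homeomorphism (smooth away from the corners) of the pillowcase $$c_\delta:P\to P,\qquad c_\delta(\gamma,\theta)=(\gamma,\theta+2f(\gamma+\pi)).$$ Using the 1-parameter family of perturbations $tf$, $t\in[0,1]$, gives an isotopy from the identity $Id:P\to P$ to $c_\delta:P\to P$.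
   Context: $SU(2)$ is the group of unit quaternions; ''traceless'' means purely imaginary. $R(A,B)$ is the space of conjugacy classes of representations $\pi_1(A\setminus B)\to SU(2)$ sending meridians of $B$ to traceless elements. Pillowcase: $P=\mathbb R^2/G$, $G$ generated by $(\gamma,\theta)\mapsto(\gamma+2\pi,\theta)$, $(\gamma,\theta)\mapsto(\gamma,\theta+2\pi)$, $(\gamma,\theta)\mapsto(-\gamma,-\theta)$; corners are the images of $(\pi\mathbb Z)^2$. With $\pi_1(S^2\setminus\{a,b,c,d\})=\langle a,b,c,d\mid ba=cd\rangle$, $P\cong R(S^2,\{a,b,c,d\})$ via $(\gamma,\theta)\mapsto(a\mapsto\mathbf i,\ b\mapsto e^{\gamma\mathbf k}\mathbf i,\ c\mapsto e^{\theta\mathbf k}\mathbf i,\ d\mapsto e^{(\theta-\gamma)\mathbf k}\mathbf i)$. Perturbation: let $e\subset S^2\setminus\{a,b,c,d\}$ be a simple closed curve separating $\{a,b\}$ from $\{c,d\}$, representing the class $ba=cd$, and let $E:S^1\times D^2\to (S^2\setminus\{a,b,c,d\})\times I$ be a tubular neighborhood of the curve obtained by pushing $e$ into the interior of $S^2\times I$. The group $\pi_1(S^2\times I\setminus(\{a,b,c,d\}\times I\cup E))$ is generated by the meridians $a,b,c,d$ of the punctures in $S^2\times\{0\}$ and the meridian $\mu_E$ of $E$; the longitude of $E$ is $\lambda_E=ba$; and the corresponding meridians of the punctures in $S^2\times\{1\}$ are $a'=a$, $b'=b$, $c'=\mu_Ec\mu_E^{-1}$, $d'=\mu_Ed\mu_E^{-1}$.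 $R_\delta(S^2\times I,\{a,b,c,d\}\times I)$ is the space of conjugacy classes of representations $\rho$ of this group in $SU(2)$ sending $a,b,c,d$ to traceless elements and satisfying: $\rho(\lambda_E)=e^{\alpha Q}$ implies $\rho(\mu_E)=e^{f(\alpha)Q}$ ($Q$ a purely imaginary unit quaternion). The second map restricts representations to the two boundary components. *)

(* Defs.v *)
From HB Require Import structures.
From mathcomp Require Import all_boot all_order all_algebra generic_quotient.
From mathcomp Require Import all_classical all_reals all_analysis.
From mathcomp Require Import ring.

Set Implicit Arguments.
Unset Strict Implicit.
Unset Printing Implicit Defensive.

Import Order.TTheory GRing.Theory Num.Theory.
Import numFieldNormedType.Exports.

Local Open Scope classical_set_scope.
Local Open Scope ring_scope.
Local Open Scope quotient_scope.

Definition homeomorphism (X Y : topologicalType) (h : X -> Y) : Prop :=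
  continuous h /\
  exists2 g : Y -> X, continuous g & cancel h g /\ cancel g h.

Definition isotopy (R : realType) (X : topologicalType)
    (H : R -> X -> X) (h0 h1 : X -> X) : Prop :=
  [/\ {within `[0, 1]%classic `*` [set: X],
        continuous (fun tx : R * X => H tx.1 tx.2)},
      forall t : R, 0 <= t <= 1 -> homeomorphism (H t),
      H 0 =1 h0 & H 1 =1 h1].

(* C^n on the open set U: continuous for n = 0, and for n.+1 differentiable
   with every directional derivative C^n.  In finite dimension this is the
   usual notion. *)
Fixpoint Cn_on (R : realType) (V W : normedModType R) (n : nat)
    (U : set V) (g : V -> W) : Prop :=
  if n is m.+1 then
    (forall x, U x -> differentiable g x) /\
    (forall v : V, Cn_on m U ('D_v g))
  else forall x, U x -> {for x, continuous g}.

Definition smooth_on (R : realType) (V W : normedModType R)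
    (U : set V) (g : V -> W) : Prop :=
  forall n, Cn_on n U g.

(* The coordinates of a quaternion are those on 1, i, j, k. The product is
   qmul below, not the componentwise product of the product ring. *)
Definition quat (R : realType) : Type := (R * R * R * R)%type.

Section Quaternions.
Context {R : realType}.
Implicit Types (p q : quat R) (t : R).

Definition qre p : R := p.1.1.1.
Definition qi p : R := p.1.1.2.
Definition qj p : R := p.1.2.
Definition qk p : R := p.2.

Definition qmul p q : quat R :=
  (qre p * qre q - qi p * qi q - qj p * qj q - qk p * qk q,
   qre p * qi q + qi p * qre q + qj p * qk q - qk p * qj q,
   qre p * qj q - qi p * qk q + qj p * qre q + qk p * qi q,
   qre p * qk q + qi p * qj q - qj p * qi q + qk p * qre q).

Definition qone : quat R := (1, 0, 0, 0).
Definition qconj p : quat R := (qre p, - qi p, - qj p, - qk p).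
Definition qnorm2 p : R := qre p ^+ 2 + qi p ^+ 2 + qj p ^+ 2 + qk p ^+ 2.

Definition unit_quat : set (quat R) := [set q | qnorm2 q = 1].
Definition pure_unit_quat : set (quat R) := [set q | qre q = 0 /\ qnorm2 q = 1].

(* e^{tQ} = cos t + (sin t) Q, for Q a purely imaginary unit quaternion *)
Definition qexp t q : quat R :=
  (cos t + sin t * qre q, sin t * qi q, sin t * qj q, sin t * qk q).

Definition quat_i : quat R := (0, 1, 0, 0).
Definition quat_k : quat R := (0, 0, 0, 1).

Lemma qmulA : associative qmul.
Proof.
by move=> [[[a b] c] d] [[[a' b'] c'] d'] [[[x y] z] w];
   rewrite /qmul /qre /qi /qj /qk /=; congr (_, _, _, _); ring.
Qed.

Lemma qmul1q : left_id qone qmul.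
Proof.
by move=> [[[a b] c] d]; rewrite /qmul /qre /qi /qj /qk /=;
   congr (_, _, _, _); ring.
Qed.

Lemma qmulq1 : right_id qone qmul.
Proof.
by move=> [[[a b] c] d]; rewrite /qmul /qre /qi /qj /qk /=;
   congr (_, _, _, _); ring.
Qed.

Lemma qnorm2M p q : qnorm2 (qmul p q) = qnorm2 p * qnorm2 q.
Proof. by rewrite /qnorm2 /qmul /qre /qi /qj /qk /=; ring. Qed.

Lemma qnorm2_conj p : qnorm2 (qconj p) = qnorm2 p.
Proof. by rewrite /qnorm2 /qconj /qre /qi /qj /qk /=; ring. Qed.

Lemma unit_quat_mul p q : unit_quat p -> unit_quat q -> unit_quat (qmul p q).
Proof. by rewrite /unit_quat /= qnorm2M => -> ->; rewrite mulr1. Qed.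

Lemma unit_quat_one : unit_quat qone.
Proof. by rewrite /unit_quat /qnorm2 /qre /qi /qj /qk /=; ring. Qed.

Lemma unit_quat_conj p : unit_quat p -> unit_quat (qconj p).
Proof. by rewrite /unit_quat /= qnorm2_conj. Qed.

Lemma qconjK p : qconj (qconj p) = p.
Proof.
by case: p => [[[a b] c] d]; rewrite /qconj /qre /qi /qj /qk /= !opprK.
Qed.

Lemma qmulVq p : unit_quat p -> qmul (qconj p) p = qone.
Proof.
rewrite /unit_quat /= /qnorm2 /qmul /qconj /qre /qi /qj /qk /= => h.
by congr (_, _, _, _); rewrite -?h; ring.
Qed.

Lemma qmulqV p : unit_quat p -> qmul p (qconj p) = qone.
Proof. by move=> /unit_quat_conj/qmulVq; rewrite qconjK. Qed.

Lemma pure_unit_quat_i : pure_unit_quat quat_i.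
Proof. by rewrite /pure_unit_quat /qnorm2 /qre /qi /qj /qk /=; split; ring. Qed.

Lemma pure_unit_quat_k : pure_unit_quat quat_k.
Proof. by rewrite /pure_unit_quat /qnorm2 /qre /qi /qj /qk /=; split; ring. Qed.

Lemma unit_quat_exp t q : pure_unit_quat q -> unit_quat (qexp t q).
Proof.
rewrite /pure_unit_quat /unit_quat /= => -[q0 q1].
rewrite -(cos2Dsin2 t) -[X in _ = _ + X]mulr1 -q1 /qnorm2 /qexp.
by rewrite q0 /qre /qi /qj /qk /=; ring.
Qed.

End Quaternions.

Definition SU2 (R : realType) : Type := set_type (@unit_quat R).

HB.instance Definition _ (R : realType) :=
  Topological.copy (SU2 R) (set_type (@unit_quat R)).

Section SU2.
Context {R : realType}.
Implicit Types x y : SU2 R.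

Definition mkSU2 (q : quat R) (hq : unit_quat q) : SU2 R :=
  exist _ q (mem_set hq).

Definition quat_of x : quat R := \val x.

Lemma quat_ofP x : unit_quat (quat_of x).
Proof. exact: set_mem (valP x). Qed.

Lemma quat_of_inj : injective quat_of.
Proof. exact: val_inj. Qed.

Definition su2_mul x y := mkSU2 (unit_quat_mul (quat_ofP x) (quat_ofP y)).
Definition su2_one : SU2 R := mkSU2 unit_quat_one.
Definition su2_inv x := mkSU2 (unit_quat_conj (quat_ofP x)).

Lemma su2_mulA : associative su2_mul.
Proof. by move=> x y z; apply: quat_of_inj; exact: qmulA. Qed.
Lemma su2_mul1g : left_id su2_one su2_mul.
Proof. by move=> x; apply: quat_of_inj; exact: qmul1q. Qed.
Lemma su2_mulg1 : right_id su2_one su2_mul.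
Proof. by move=> x; apply: quat_of_inj; exact: qmulq1. Qed.
Lemma su2_mulVg : left_inverse su2_one su2_inv su2_mul.
Proof. by move=> x; apply: quat_of_inj; exact: qmulVq (quat_ofP x). Qed.
Lemma su2_mulgV : right_inverse su2_one su2_inv su2_mul.
Proof. by move=> x; apply: quat_of_inj; exact: qmulqV (quat_ofP x). Qed.

HB.instance Definition _ :=
  isGroup.Build (SU2 R) su2_mulA su2_mul1g su2_mulg1 su2_mulVg su2_mulgV.

Definition traceless x : Prop := qre (quat_of x) = 0.

Definition su2_i : SU2 R := mkSU2 pure_unit_quat_i.2.
Definition su2_expk (t : R) : SU2 R := mkSU2 (unit_quat_exp t pure_unit_quat_k).

Lemma quat_ofM x y : quat_of (x * y)%g = qmul (quat_of x) (quat_of y).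
Proof. by []. Qed.

Lemma quat_ofV x : quat_of (x^-1)%g = qconj (quat_of x).
Proof. by []. Qed.

Lemma quat_of_i : quat_of su2_i = (0, 1, 0, 0).
Proof. by []. Qed.

Lemma quat_of_expk (t : R) : quat_of (su2_expk t) = (cos t, 0, 0, sin t).
Proof.
by rewrite /quat_of /= /qexp /qre /qi /qj /qk /= !mulr0 addr0 mulr1.
Qed.

End SU2.

Inductive letter (X : Type) := Gen of X | Inv of X.
Arguments Gen {X}.
Arguments Inv {X}.

Definition word (X : Type) := seq (letter X).

Section Words.
Context {G : groupType}.

Definition ev_letter (X : Type) (rho : X -> G) (l : letter X) : G :=
  match l with Gen x => rho x | Inv x => ((rho x)^-1)%g end.

Definition ev (X : Type) (rho : X -> G) (w : word X) : G :=
  (\prod_(l <- w) ev_letter rho l)%g.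

Lemma ev_nil (X : Type) (rho : X -> G) : ev rho [::] = 1%g.
Proof. exact: big_nil. Qed.

Lemma ev_cons (X : Type) (rho : X -> G) l (w : word X) :
  ev rho (l :: w) = (ev_letter rho l * ev rho w)%g.
Proof. exact: big_cons. Qed.

Definition conjugate (X : Type) (rho sigma : X -> G) : Prop :=
  exists g : G, forall x, sigma x = (g * rho x * g^-1)%g.

Lemma conjugate_refl X (rho : X -> G) : conjugate rho rho.
Proof. by exists 1%g => x; rewrite invg1 mulg1 mul1g. Qed.

Lemma conjugate_sym X (rho sigma : X -> G) :
  conjugate rho sigma -> conjugate sigma rho.
Proof.
by move=> [g h]; exists (g^-1)%g => x; rewrite h invgK !mulgA mulVg mul1g mulgVK.
Qed.

Lemma conjugate_trans X (rho sigma tau : X -> G) :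
  conjugate rho sigma -> conjugate sigma tau -> conjugate rho tau.
Proof.
by move=> [g h] [g' h']; exists (g' * g)%g => x; rewrite h' h invgM !mulgA.
Qed.

Lemma ev_conjugate X (rho sigma : X -> G) (g : G) (w : word X) :
  (forall x, sigma x = (g * rho x * g^-1)%g) ->
  ev sigma w = (g * ev rho w * g^-1)%g.
Proof.
move=> h; rewrite /ev; elim: w => [|l w IH].
  by rewrite !big_nil mulg1 mulgV.
rewrite !big_cons IH !mulgA; congr (_ * _ * _)%g.
by case: l => x /=; rewrite h ?invgM ?invgK ?mulgA mulgVK.
Qed.

End Words.

Section Representations.
Context {R : realType}.

(* In what follows A is the set of those assignments X -> SU(2) of the
   generators X of a presented group that are representations of the kind
   considered. *)
Definition class_rel (X : Type) (A : set {ptws X -> SU2 R})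
    (r s : set_type A) : bool := `[< conjugate (\val r) (\val s) >].

Lemma class_rel_refl X (A : set {ptws X -> SU2 R}) : reflexive (@class_rel X A).
Proof. by move=> r; apply/asboolP; exact: conjugate_refl. Qed.

Lemma class_rel_sym X (A : set {ptws X -> SU2 R}) : symmetric (@class_rel X A).
Proof.
by move=> r s; apply/idP/idP => /asboolP h; apply/asboolP; exact: conjugate_sym.
Qed.

Lemma class_rel_trans X (A : set {ptws X -> SU2 R}) :
  transitive (@class_rel X A).
Proof.
move=> s r t /asboolP h /asboolP h'; apply/asboolP.
exact: conjugate_trans h h'.
Qed.

Canonical class_equiv (X : Type) (A : set {ptws X -> SU2 R}) :
    equiv_rel (set_type A) :=
  EquivRel (@class_rel X A) (@class_rel_refl X A) (@class_rel_sym X A)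
    (@class_rel_trans X A).

Definition classes_of (X : Type) (A : set {ptws X -> SU2 R}) : Type :=
  quotient_topology {eq_quot (class_equiv A)}.

HB.instance Definition _ (X : Type) (A : set {ptws X -> SU2 R}) :=
  Topological.copy (classes_of A)
    (quotient_topology {eq_quot (class_equiv A)}).

Definition class_of (X : Type) (A : set {ptws X -> SU2 R}) (r : set_type A) :
  classes_of A := \pi_(quotient_topology {eq_quot (class_equiv A)}) r.

Definition rep_of (X : Type) (A : set {ptws X -> SU2 R}) (x : classes_of A) :
  set_type A := repr (x : quotient_topology {eq_quot (class_equiv A)}).

Lemma class_ofP X (A : set {ptws X -> SU2 R}) (r s : set_type A) :
  class_of r = class_of s <-> conjugate (\val r) (\val s).
Proof.
by split=> [h|h]; [apply/asboolP/(eqmodP (class_equiv A)) |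
  apply/(eqmodP (class_equiv A))/asboolP].
Qed.

Lemma rep_ofK X (A : set {ptws X -> SU2 R}) (x : classes_of A) :
  class_of (rep_of x) = x.
Proof. exact: (@reprK _ (quotient_topology {eq_quot (class_equiv A)})). Qed.

Definition rep_at (X : Type) (A : set {ptws X -> SU2 R})
    (rho : {ptws X -> SU2 R}) (h : A rho) : set_type A :=
  exist _ rho (mem_set h).

Lemma rep_atP X (A : set {ptws X -> SU2 R}) (r : set_type A) : A (\val r).
Proof. exact: set_mem (valP r). Qed.

(* A homomorphism into a presented group, given by words in the generators X
   that are the images of the generators Y, induces a map on representations. *)
Definition pullback (X Y : Type) (phi : Y -> word X) (rho : X -> SU2 R) :
  {ptws Y -> SU2 R} := fun y => ev rho (phi y).

Definition restriction (X Y : Type) (A : set {ptws X -> SU2 R})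
    (B : set {ptws Y -> SU2 R}) (phi : Y -> word X)
    (h : forall rho, A rho -> B (pullback phi rho)) :
    classes_of A -> classes_of B :=
  fun x => class_of (rep_at (h _ (rep_atP (rep_of x)))).

Lemma restrictionE X Y (A : set {ptws X -> SU2 R}) (B : set {ptws Y -> SU2 R})
    (phi : Y -> word X) (h : forall rho, A rho -> B (pullback phi rho))
    (r : set_type A) :
  restriction h (class_of r) = class_of (rep_at (h _ (rep_atP r))).
Proof.
apply/class_ofP => /=.
have /class_ofP[g hg] := rep_ofK (class_of r).
exists g => y; rewrite /pullback; exact: ev_conjugate.
Qed.

End Representations.

(* The meridians of the four punctures, generating
   pi_1(S^2 \ {a,b,c,d}) = < a, b, c, d | ba = cd >. *)
Inductive puncture := pa | pb | pc | pd.

(* The generators of pi_1(S^2 x I \ ({a,b,c,d} x I \cup E)): the meridians at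
   S^2 x {0} and the meridian mu_E.  By van Kampen the relations are ba = cd
   and [mu_E, lambda_E] = 1, where lambda_E = ba. *)
Inductive cyl_gen := Mer of puncture | MuE.

Definition puncture_code (p : puncture) : bool * bool :=
  match p with
  | pa => (false, false) | pb => (false, true)
  | pc => (true, false) | pd => (true, true)
  end.
Definition puncture_decode (x : bool * bool) : puncture :=
  match x with
  | (false, false) => pa | (false, true) => pb
  | (true, false) => pc | (true, true) => pd
  end.
Lemma puncture_codeK : cancel puncture_code puncture_decode.
Proof. by case. Qed.

HB.instance Definition _ := Finite.copy puncture (can_type puncture_codeK).

Definition cyl_gen_code (x : cyl_gen) : option puncture :=
  if x is Mer p then Some p else None.
Definition cyl_gen_decode (x : option puncture) : cyl_gen :=
  if x is Some p then Mer p else MuE.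
Lemma cyl_gen_codeK : cancel cyl_gen_code cyl_gen_decode.
Proof. by case. Qed.

HB.instance Definition _ := Finite.copy cyl_gen (can_type cyl_gen_codeK).

Definition lambdaE : word cyl_gen := [:: Gen (Mer pb); Gen (Mer pa)].

Definition incl0 (p : puncture) : word cyl_gen := [:: Gen (Mer p)].

Definition incl1 (p : puncture) : word cyl_gen :=
  match p with
  | pa | pb => [:: Gen (Mer p)]
  | pc | pd => [:: Gen MuE; Gen (Mer p); Inv MuE]
  end.

Section CharacterVarieties.
Context {R : realType}.

Definition sphere_rep : set {ptws puncture -> SU2 R} :=
  [set rho | ev rho [:: Gen pb; Gen pa] = ev rho [:: Gen pc; Gen pd] /\
             forall p, traceless (rho p)].

Definition cyl_rep (f : R -> R) : set {ptws cyl_gen -> SU2 R} :=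
  [set rho |
    [/\ ev rho [:: Gen (Mer pb); Gen (Mer pa)] =
          ev rho [:: Gen (Mer pc); Gen (Mer pd)],
        ev rho (Gen MuE :: lambdaE) = ev rho (rcons lambdaE (Gen MuE)),
        forall p, traceless (rho (Mer p)) &
        forall (alpha : R) (Q : quat R), pure_unit_quat Q ->
          quat_of (ev rho lambdaE) = qexp alpha Q ->
          quat_of (rho MuE) = qexp (f alpha) Q]].

Lemma traceless_conj (g x : SU2 R) :
  traceless x -> traceless (g * x * g^-1)%g.
Proof.
move=> hx; rewrite /traceless.
suff -> : qre (quat_of (g * x * g^-1)%g)
    = qnorm2 (quat_of g) * qre (quat_of x) by rewrite hx mulr0.
rewrite !quat_ofM quat_ofV.
move: (quat_of g) (quat_of x) => p q.
by rewrite /qnorm2 /qmul /qconj /qre /qi /qj /qk /=; ring.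
Qed.

Lemma incl0_rep f rho : cyl_rep f rho -> sphere_rep (pullback incl0 rho).
Proof.
move=> [h _ t _]; rewrite /sphere_rep /pullback /incl0 /=; split=> [|p].
  by move: h; do !rewrite ev_cons ?ev_nil /= ?mulg1.
by rewrite ev_cons ev_nil mulg1; exact: t.
Qed.

Lemma conj_prod (G : groupType) (a b c d m : G) :
  (b * a = c * d -> m * (b * a) = b * (a * m) ->
   b * a = m * (c * (m^-1 * (m * (d * m^-1)))))%g.
Proof. by move=> h k; rewrite mulKg !mulgA -(mulgA m) -h k mulgA mulgK. Qed.

Lemma incl1_rep f rho : cyl_rep f rho -> sphere_rep (pullback incl1 rho).
Proof.
move=> [h k t _]; rewrite /sphere_rep /pullback /=; split=> [|p].
  move: h k; rewrite /incl1 /lambdaE /=; do !rewrite ev_cons ?ev_nil /= ?mulg1.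
  by rewrite -!mulgA; exact: conj_prod.
have tc : traceless (rho MuE * rho (Mer p) * (rho MuE)^-1)%g.
  exact/traceless_conj/t.
by case: p tc => tc; do !rewrite ev_cons ?ev_nil /= ?mulg1; rewrite ?mulgA;
  (exact: tc || exact: t).
Qed.

(* R(S^2, {a,b,c,d}) and R_delta(S^2 x I, {a,b,c,d} x I) for delta = (E, f) *)
Definition R_sphere : Type := classes_of sphere_rep.
Definition R_delta (f : R -> R) : Type := classes_of (cyl_rep f).

HB.instance Definition _ := Topological.copy R_sphere (classes_of sphere_rep).
HB.instance Definition _ (f : R -> R) :=
  Topological.copy (R_delta f) (classes_of (cyl_rep f)).

Definition restr0 (f : R -> R) : R_delta f -> R_sphere :=
  restriction (@incl0_rep f).
Definition restr1 (f : R -> R) : R_delta f -> R_sphere :=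
  restriction (@incl1_rep f).

End CharacterVarieties.

Section Pillowcase.
Context {R : realType}.
Implicit Types v w : R * R.

Inductive pillow_group : (R * R -> R * R) -> Prop :=
  | pillow_gamma : pillow_group (fun v => (v.1 + 2 * pi, v.2))
  | pillow_theta : pillow_group (fun v => (v.1, v.2 + 2 * pi))
  | pillow_neg : pillow_group (fun v => (- v.1, - v.2))
  | pillow_id : pillow_group id
  | pillow_comp g h : pillow_group g -> pillow_group h -> pillow_group (g \o h)
  | pillow_inv g h : pillow_group g -> cancel g h -> cancel h g ->
      pillow_group h.

Definition pillow_rel v w : bool := `[< exists2 g, pillow_group g & g v = w >].

Lemma pillow_group_bij g : pillow_group g ->
  exists h, [/\ pillow_group h, cancel g h & cancel h g].
Proof.
elim=> {g} [||||g h _ [g' [pg gK gK']] _ [h' [ph hK hK']]|g h pg _ gK hK].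
- exists (fun v => (v.1 - 2 * pi, v.2)).
  have c1 : cancel (fun v => (v.1 + 2 * pi, v.2)) (fun v => (v.1 - 2 * pi, v.2)).
    by move=> [x y] /=; rewrite addrK.
  have c2 : cancel (fun v => (v.1 - 2 * pi, v.2)) (fun v => (v.1 + 2 * pi, v.2)).
    by move=> [x y] /=; rewrite subrK.
  by split=> //; exact: pillow_inv pillow_gamma c1 c2.
- exists (fun v => (v.1, v.2 - 2 * pi)).
  have c1 : cancel (fun v => (v.1, v.2 + 2 * pi)) (fun v => (v.1, v.2 - 2 * pi)).
    by move=> [x y] /=; rewrite addrK.
  have c2 : cancel (fun v => (v.1, v.2 - 2 * pi)) (fun v => (v.1, v.2 + 2 * pi)).
    by move=> [x y] /=; rewrite subrK.
  by split=> //; exact: pillow_inv pillow_theta c1 c2.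
- exists (fun v => (- v.1, - v.2)).
  by split=> [|[x y]|[x y]] /=; rewrite ?opprK //; exact: pillow_neg.
- by exists id; split=> //; exact: pillow_id.
- exists (h' \o g'); split; [exact: pillow_comp|exact: can_comp|exact: can_comp].
- by exists g.
Qed.

Lemma pillow_rel_refl : reflexive pillow_rel.
Proof. by move=> v; apply/asboolP; exists id => //; exact: pillow_id. Qed.

Lemma pillow_rel_sym : symmetric pillow_rel.
Proof.
have H v w : pillow_rel v w -> pillow_rel w v.
  move=> /asboolP[g pg <-]; have [h [ph gK _]] := pillow_group_bij pg.
  by apply/asboolP; exists h.
by move=> v w; apply/idP/idP; exact: H.
Qed.

Lemma pillow_rel_trans : transitive pillow_rel.
Proof.
move=> w v u /asboolP[g pg <-] /asboolP[h ph <-]; apply/asboolP.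
by exists (h \o g) => //; exact: pillow_comp.
Qed.

Canonical pillow_equiv : equiv_rel (R * R)%type :=
  EquivRel pillow_rel pillow_rel_refl pillow_rel_sym pillow_rel_trans.

Definition pillowcase : Type := quotient_topology {eq_quot pillow_equiv}.

HB.instance Definition _ :=
  Topological.copy pillowcase (quotient_topology {eq_quot pillow_equiv}).

Definition pillow v : pillowcase :=
  \pi_(quotient_topology {eq_quot pillow_equiv}) v.
Definition pillow_repr (x : pillowcase) : R * R :=
  repr (x : quotient_topology {eq_quot pillow_equiv}).

Lemma pillowP v w : pillow v = pillow w <-> exists2 g, pillow_group g & g v = w.
Proof.
by split=> [h|h]; [apply/asboolP/(eqmodP pillow_equiv) |
  apply/(eqmodP pillow_equiv)/asboolP].
Qed.

Lemma pillow_reprK x : pillow (pillow_repr x) = x.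
Proof. exact: (@reprK _ (quotient_topology {eq_quot pillow_equiv})). Qed.

Definition pillow_corner v : Prop :=
  exists m n : int, v = (m%:~R * pi, n%:~R * pi).

(* A function on the pillowcase away from the corners is smooth when it lifts
   locally to a smooth function of (gamma, theta): the projection from the
   plane is a covering there, and its local inverses are the charts. *)
Definition smooth_off_corners (h : pillowcase -> pillowcase) : Prop :=
  forall v, ~ pillow_corner v ->
    (forall w, pillow w = h (pillow v) -> ~ pillow_corner w) /\
    exists (U : set (R * R)) (g : R * R -> R * R),
      [/\ open U, U v, smooth_on U g &
          forall u, U u -> h (pillow u) = pillow (g u)].

Definition pillow_rep (v : R * R) : {ptws puncture -> SU2 R} := fun p =>
  match p with
  | pa => su2_i
  | pb => (su2_expk v.1 * su2_i)%g
  | pc => (su2_expk v.2 * su2_i)%g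
  | pd => (su2_expk (v.2 - v.1) * su2_i)%g
  end.

Lemma su2_expk2pi (s : R) : su2_expk (s + 2 * pi) = su2_expk s.
Proof.
have e : 2 * pi = pi *+ 2 :> R by rewrite mulr_natl.
by apply: quat_of_inj; rewrite !quat_of_expk e cosD2pi sinD2pi.
Qed.

Lemma su2_expkN (s : R) :
  (su2_expk (- s) * su2_i = su2_i * (su2_expk s * su2_i) * su2_i^-1)%g.
Proof.
apply: quat_of_inj; rewrite !quat_ofM quat_ofV !quat_of_expk quat_of_i cosN sinN.
move: (cos s) (sin s) => a b; rewrite /qmul /qconj /qre /qi /qj /qk /=.
by congr (_, _, _, _); ring.
Qed.

Lemma pillow_rep_sphere v : sphere_rep (pillow_rep v).
Proof.
split=> [|[]].
- rewrite /ev !big_cons !big_nil /= !mulg1; apply: quat_of_inj.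
  rewrite !quat_ofM !quat_of_expk quat_of_i /qmul /qre /qi /qj /qk /=.
  have -> : cos v.1 = cos v.2 * cos (v.2 - v.1) + sin v.2 * sin (v.2 - v.1).
    by rewrite -cosB; congr cos; ring.
  have -> : sin v.1 = sin v.2 * cos (v.2 - v.1) - cos v.2 * sin (v.2 - v.1).
    by rewrite -sinB; congr sin; ring.
  by congr (_, _, _, _); ring.
- by [].
- by rewrite /traceless quat_ofM quat_of_expk quat_of_i /qmul /qre /qi /qj /qk /=; ring.
- by rewrite /traceless quat_ofM quat_of_expk quat_of_i /qmul /qre /qi /qj /qk /=; ring.
- by rewrite /traceless quat_ofM quat_of_expk quat_of_i /qmul /qre /qi /qj /qk /=; ring.
Qed.

(* The identification of P with R(S^2, {a,b,c,d}), defined through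
   representatives; pillow_isoE is its description on all of the plane. *)
Definition pillow_iso (x : pillowcase) : R_sphere :=
  class_of (rep_at (pillow_rep_sphere (pillow_repr x))).

Lemma pillow_rep_invariant g v : pillow_group g ->
  conjugate (pillow_rep v) (pillow_rep (g v)).
Proof.
move=> pg; elim: pg v => {g}
    [||||g h _ IHg _ IHh|g h _ IHg gK hK] v.
- exists 1%g => p; rewrite invg1 mulg1 mul1g.
  case: p => //=; rewrite ?su2_expk2pi//.
  rewrite -(su2_expk2pi (v.2 - (v.1 + 2 * pi))); congr (su2_expk _ * _)%g.
  by ring.
- exists 1%g => p; rewrite invg1 mulg1 mul1g.
  case: p => //=; rewrite ?su2_expk2pi//.
  rewrite -(su2_expk2pi (v.2 - v.1)); congr (su2_expk _ * _)%g.
  by ring.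
- exists su2_i; case => /=; rewrite ?mulgK// -?su2_expkN//.
  by congr (su2_expk _ * _)%g; ring.
- exact: conjugate_refl.
- exact: conjugate_trans (IHh v) (IHg (h v)).
- by apply: conjugate_sym; rewrite -{2}(hK v); exact: IHg.
Qed.

Lemma pillow_isoE v :
  pillow_iso (pillow v) = class_of (rep_at (pillow_rep_sphere v)).
Proof.
apply/class_ofP => /=.
have /pillowP[g pg {2}<-] := pillow_reprK (pillow v).
exact: pillow_rep_invariant.
Qed.

(* The result does not depend on the representative when f is odd and
   2pi-periodic. *)
Definition c_delta (f : R -> R) (x : pillowcase) : pillowcase :=
  let v := pillow_repr x in pillow (v.1, v.2 + 2 * f (v.1 + pi)).

End Pillowcase.

Arguments pillowcase R : clear implicits.
Arguments R_sphere R : clear implicits.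

(* Main.v *)
Require Import Defs.
From mathcomp Require Import all_boot all_order all_algebra.
From mathcomp Require Import all_classical all_reals all_analysis.
From mathcomp Require Import ring lra.

Set Implicit Arguments.
Unset Strict Implicit.
Unset Printing Implicit Defensive.

Import Order.TTheory GRing.Theory Num.Theory.
Import numFieldNormedType.Exports.

Local Open Scope ring_scope.
Local Open Scope classical_set_scope.

(** A representation in R_delta is determined by its values on the meridians
a, b, c, d: any unit quaternion can be written e^{alpha Q}, so the perturbation
condition reads rho(mu_E) from rho(ba).  For the representation with
coordinates (gamma, theta) one has ba = e^{gamma k} i i = e^{(gamma + pi) k},
hence mu_E = e^{f(gamma + pi) k}; conjugating c = e^{theta k} i and
d = e^{(theta - gamma) k} i by it adds 2 f(gamma + pi) to both angles, while a
and b are unchanged.  This is the shear c_delta, and its inverse is the shear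
for - f.

For mu_E to be well defined, f must not distinguish the different ways of
writing ba as an exponential: e^{x Q} = e^{y Q'} has to imply
e^{f(x) Q} = e^{f(y) Q'}.  Oddness and periodicity give exactly this
([qexp_odd_periodic]); in particular f vanishes on pi Z, which takes care of
ba = 1 and ba = - 1, where Q is arbitrary.

That every representation has coordinates is [sphere_rep_pillow]: from
d = c^-1 b a and tr d = 0, the vectors a, b, c in R^3 have triple product zero,
so they lie in a plane, which a conjugation carries to the plane of i and j
with a going to i.  The point of the pillowcase is recovered from the real
parts of ab, ac and ad, which are - cos gamma, - cos theta and
- cos (theta - gamma): the first two leave the signs of the angles open, and
the third one decides whether the signs agree ([pillow_cos]).

These real parts are continuous class functions to R^3.  So both maps from the
compact pillowcase, to R(S^2, {a,b,c,d}) and to R_delta, are continuous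
surjections that become injective after composition with a continuous map to a
Hausdorff space, and this makes them homeomorphisms ([compact_homeomorphism]);
restriction to S^2 x {0} is the quotient of the two.  The family t f is jointly
continuous on the pillowcase because the projection from the plane is an open
map ([pillow_open]). *)

(** * Topological preliminaries *)

Lemma continuous_prod (X Y Z : topologicalType) (f : X -> Y) (g : X -> Z) :
  continuous f -> continuous g -> continuous (fun x => (f x, g x)).
Proof. by move=> cf cg x; apply: cvg_pair; [exact: cf | exact: cg]. Qed.

Lemma continuous_ptws (I : Type) (X : topologicalType)
    (K : I -> topologicalType) (F : X -> prod_topology K) :
  (forall i, continuous (fun x => F x i)) -> continuous F.
Proof.
move=> cF x; apply/cvg_sup => i.
move: x; apply/(@continuousP _ (initial_topology (@^~ i))) => A [B oB <-].
by have /continuousP := cF i; apply.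
Qed.

(** Continuity of the inverse: the preimage under T of the compact, hence
closed, set T (h C) is h C, for C closed.  The map T stands in for separation
of Y: for a space of conjugacy classes it is given by class functions. *)
Lemma compact_homeomorphism (X Y Z : topologicalType)
    (h : X -> Y) (T : Y -> Z) :
  compact [set: X] -> hausdorff_space Z ->
  continuous h -> continuous T -> injective (T \o h) ->
  (forall y, exists x, h x = y) -> homeomorphism h.
Proof.
move=> cX hZ ch cT inj /choice[g hg].
split=> //; exists g; last by split=> // x; apply: inj => /=; rewrite hg.
apply/continuous_closedP => C cC.
have -> : g @^-1` C = T @^-1` ((T \o h) @` C).
  apply/seteqP; split=> y /=; first by move=> Cgy; exists (g y); rewrite ?hg.
  by move=> [x Cx]; rewrite -{1}(hg y) => /inj <-.
apply: (proj1 (continuous_closedP _) cT); apply: compact_closed => //.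
apply: continuous_compact; last exact: subclosed_compact cC cX _.
apply: continuous_subspaceT => x.
by apply: continuous_comp; [exact: ch|exact: cT].
Qed.

Lemma homeo_comp (X Y Z : topologicalType) (h : X -> Y) (k : Y -> Z) :
  homeomorphism h -> homeomorphism k -> homeomorphism (k \o h).
Proof.
move=> [ch [h' ch' [hK h'K]]] [ck [k' ck' [kK k'K]]]; split.
  by move=> x; apply: continuous_comp; [exact: ch|exact: ck].
exists (h' \o k'); last by split; exact: can_comp.
by move=> x; apply: continuous_comp; [exact: ck'|exact: ch'].
Qed.

Lemma homeo_of_comp (X Y Z : topologicalType) (h : X -> Y) (k : Y -> Z) :
  homeomorphism h -> homeomorphism (k \o h) -> homeomorphism k.
Proof.
move=> [ch [h' ch' [hK h'K]]] kh.
have hh' : homeomorphism h' by split=> //; exists h.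
have := homeo_comp hh' kh; rewrite (_ : (k \o h) \o h' = k) //.
by apply/funext => y /=; rewrite h'K.
Qed.

(** * Angles and points of the pillowcase *)

Section Angles.
Context {R : realType}.
Implicit Types x y : R.

Lemma cos_eq1_02pi x : 0 <= x < 2 * pi -> cos x = 1 -> x = 0.
Proof.
move=> /andP[x0 x2] cx; have pi0 := @pi_gt0 R.
have [xpi|xpi] := leP x pi.
  by apply: cos_inj; rewrite ?in_itv/= ?x0 ?xpi ?lexx ?pi_ge0// cos0.
have : 2 * pi - x = 0.
  apply: cos_inj; rewrite ?in_itv/=; [lra|lra|].
  rewrite cos0 mulr_natl cosB cos2pi sin2pi cx; lra.
lra.
Qed.

Lemma periodic_int (V : Type) (g : R -> V) (T : R) :
  (forall x, g (x + T) = g x) -> forall (n : int) x, g (x + n%:~R * T) = g x.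
Proof.
move=> gT n; have gTn (k : nat) x : g (x + k%:R * T) = g x.
  elim: k x => [|k IH] x; first by rewrite mul0r addr0.
  by rewrite -natr1 mulrDl mul1r addrA gT IH.
case: n => n x; first exact: gTn.
by rewrite -[LHS](gTn n.+1) NegzE mulrNz mulNr -addrA addNr addr0.
Qed.

Lemma cosD2piE x : cos (x + 2 * pi) = cos x.
Proof. by rewrite mulr_natl cosD2pi. Qed.

Lemma sinD2piE x : sin (x + 2 * pi) = sin x.
Proof. by rewrite mulr_natl sinD2pi. Qed.

Lemma reduce_2pi x : exists n : int, 0 <= x + n%:~R * (2 * pi) < 2 * pi.
Proof.
have p2 : 0 < 2 * pi :> R by have := @pi_gt0 R; lra.
exists (- Num.floor (x / (2 * pi))).
have /andP[] := floor_itv (x / (2 * pi)).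
rewrite ler_pdivlMr// ltr_pdivrMr// intrD mulrNz => n1 n2.
by apply/andP; split; lra.
Qed.

Lemma cos_sin_inj x y : cos x = cos y -> sin x = sin y ->
  exists n : int, x = y + n%:~R * (2 * pi).
Proof.
move=> cxy sxy; have [n xy] := reduce_2pi (x - y); exists (- n).
suff : x - y + n%:~R * (2 * pi) = 0 by rewrite mulrNz; lra.
apply: cos_eq1_02pi => //.
have [ck sk] : cos (n%:~R * (2 * pi)) = 1 :> R /\
    sin (n%:~R * (2 * pi)) = 0 :> R.
  by rewrite -[n%:~R * _]add0r (periodic_int cosD2piE) (periodic_int sinD2piE)
    cos0 sin0.
by rewrite cosD ck sk cosB cxy sxy -!expr2 cos2Dsin2; ring.
Qed.

Lemma polar x y : x ^+ 2 + y ^+ 2 = 1 -> exists t, x = cos t /\ y = sin t.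
Proof.
move=> xy.
have x1 : -1 <= x <= 1.
  by rewrite -ler_norml -(@expr_le1 _ 2)// real_normK ?num_real//; nra.
have c : cos (acos x) = x by apply: acosK.
have s2 : sin (acos x) ^+ 2 = y ^+ 2 by rewrite sin2cos2 c -xy; lra.
move/eqP: s2; rewrite eqf_sqr => /orP[]/eqP s.
  by exists (acos x); rewrite c s.
by exists (- acos x); rewrite cosN sinN c s opprK.
Qed.

Lemma pillow_shift (m n : int) x y :
  pillow (x + m%:~R * (2 * pi), y + n%:~R * (2 * pi)) = pillow (x, y).
Proof.
rewrite (@periodic_int _ (fun x => pillow (x, _))) => [|{}x].
  apply: (@periodic_int _ (fun y => pillow (_, y))) => {}y.
  apply/esym/pillowP; exists (fun v => (v.1, v.2 + 2 * pi)) => //.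
  exact: pillow_theta.
apply/esym/pillowP; exists (fun v => (v.1 + 2 * pi, v.2)) => //.
exact: pillow_gamma.
Qed.

Lemma pillowN x y : pillow (- x, - y) = pillow (x, y).
Proof.
apply/esym/pillowP; exists (fun v => (- v.1, - v.2)) => //.
exact: pillow_neg.
Qed.

Lemma pillow_cos_sin x y x' y' :
  cos x = cos x' -> sin x = sin x' -> cos y = cos y' -> sin y = sin y' ->
  pillow (x, y) = pillow (x', y').
Proof.
move=> cx sx cy sy; have [m ->] := cos_sin_inj cx sx.
by have [n ->] := cos_sin_inj cy sy; exact: pillow_shift.
Qed.

(** The equations on cosines determine the sines of the two angles up to a sign
each.  Equal signs give the same point, up to (x, y) -> (- x, - y); when the
signs differ, the third equation gives sin x' sin y' = 0, and then the sign of
one of the two angles is immaterial. *)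
Lemma pillow_cos x y x' y' : cos x = cos x' -> cos y = cos y' ->
  cos (y - x) = cos (y' - x') -> pillow (x, y) = pillow (x', y').
Proof.
move=> cx cy; rewrite !cosB cx cy => /addrI cyx.
have : sin x ^+ 2 == sin x' ^+ 2 by rewrite !sin2cos2 cx.
have : sin y ^+ 2 == sin y' ^+ 2 by rewrite !sin2cos2 cy.
have pN : sin x = - sin x' -> sin y = - sin y' ->
    pillow (x, y) = pillow (x', y').
  move=> sx sy; rewrite -[RHS]pillowN.
  by apply: pillow_cos_sin; rewrite ?cosN ?sinN.
have p : sin x = sin x' -> sin y = sin y' -> pillow (x, y) = pillow (x', y').
  by move=> sx sy; apply: pillow_cos_sin.
rewrite !eqf_sqr => /orP[]/eqP sy /orP[]/eqP sx; [exact: p| | |exact: pN].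
- have /eqP : sin x' * sin y' = 0 by move: cyx; rewrite sx sy; lra.
  rewrite mulf_eq0 => /orP[]/eqP s0; [apply: p|apply: pN]; lra.
- have /eqP : sin x' * sin y' = 0 by move: cyx; rewrite sx sy; lra.
  rewrite mulf_eq0 => /orP[]/eqP s0; [apply: pN|apply: p]; lra.
Qed.
End Angles.

(** * Conjugation of traceless quaternions *)

Section Conjugation.
Context {R : realType}.
Implicit Types (a b c d g : SU2 R) (s t : R) (Q : quat R).

Lemma quat_expki t : quat_of (su2_expk t * su2_i)%g = (0, cos t, sin t, 0).
Proof.
rewrite quat_ofM quat_of_expk quat_of_i /qmul /qre /qi /qj /qk /=.
by congr (_, _, _, _); ring.
Qed.

Lemma expki_i t : (su2_expk t * su2_i * su2_i)%g = su2_expk (t + pi).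
Proof.
apply: quat_of_inj; rewrite quat_ofM quat_expki quat_of_expk quat_of_i.
by rewrite cosDpi sinDpi /qmul /qre /qi /qj /qk /=; congr (_, _, _, _); ring.
Qed.

Lemma expkD s t : (su2_expk s * su2_expk t)%g = su2_expk (s + t).
Proof.
apply: quat_of_inj; rewrite quat_ofM !quat_of_expk cosD sinD.
by rewrite /qmul /qre /qi /qj /qk /=; congr (_, _, _, _); ring.
Qed.

Lemma expk_conj_expki s t :
  (su2_expk s * (su2_expk t * su2_i) * (su2_expk s)^-1
   = su2_expk (t + 2 * s) * su2_i)%g.
Proof.
apply: quat_of_inj.
rewrite quat_ofM (quat_ofM (su2_expk s)) quat_ofV !quat_expki quat_of_expk.
rewrite mulr_natl mulr2n !(cosD, sinD).
move: (cos s) (sin s) (cos t) (sin t) => x y z w.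
by rewrite /qmul /qconj /qre /qi /qj /qk /=; congr (_, _, _, _); ring.
Qed.

Lemma intertwine Q a b : unit_quat Q ->
  qmul Q (quat_of a) = qmul (quat_of b) Q ->
  exists g, quat_of g = Q /\ (g * a * g^-1)%g = b.
Proof.
move=> u h; exists (mkSU2 u); split=> //.
suff -> : (mkSU2 u * a = b * mkSU2 u)%g by rewrite mulgK.
exact: quat_of_inj.
Qed.

(** The quaternion 1 - i a intertwines a and i, since i and a square to - 1; it
vanishes only for a = - i. *)
Lemma conj_to_i a : traceless a -> exists g, (g * a * g^-1)%g = su2_i.
Proof.
move=> ta; have := quat_ofP a; move: ta; rewrite /traceless.
case E : (quat_of a) => [[[a0 a1] a2] a3].
rewrite /unit_quat /qnorm2 /qre /qi /qj /qk /=.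
move=> a00 na.
have [a1N|a1N] := eqVneq a1 (-1).
  (* a = - i, and k i = - i k. *)
  have ? : a2 = 0 by nra.
  have ? : a3 = 0 by nra.
  subst; exists (su2_expk (pi / 2)); apply: quat_of_inj.
  rewrite !quat_ofM quat_ofV quat_of_expk cos_pihalf sin_pihalf quat_of_i E.
  by rewrite /qmul /qconj /qre /qi /qj /qk /=; congr (_, _, _, _); ring.
have a1lt : 0 < 2 + 2 * a1.
  have : -1 < a1 by rewrite lt_neqAle eq_sym a1N /=; nra.
  lra.
(* The norm of 1 - i a. *)
pose s : R := Num.sqrt (2 + 2 * a1).
have s2 : s ^+ 2 = 2 + 2 * a1 by rewrite sqr_sqrtr// ltW.
have s0 : s != 0 by rewrite gt_eqF// sqrtr_gt0.
pose r : R := s^-1.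
have r2 : r ^+ 2 * (2 + 2 * a1) = 1 by rewrite /r -s2; field.
have u : unit_quat ((r * (1 + a1), 0, r * a3, - r * a2) : quat R).
  rewrite /unit_quat /qnorm2 /qre /qi /qj /qk /= -[RHS]r2.
  have a3E : a3 ^+ 2 = 1 - a1 ^+ 2 - a2 ^+ 2 by rewrite -na a00; ring.
  by rewrite !exprMn a3E; ring.
have [|g [_ ga]] := @intertwine _ a su2_i u; last by exists g.
rewrite quat_of_i E a00.
rewrite /qmul /qre /qi /qj /qk /=.
have a3E : a3 * a3 = 1 - a1 ^+ 2 - a2 ^+ 2 by rewrite -na a00; ring.
by congr (_, _, _, _); ring: a3E.
Qed.

(** The hypothesis says that the components of b and c in the plane of j and k
are parallel; conjugation by e^{s i} rotates this plane by 2 s. *)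
Lemma flatten b c : traceless b -> traceless c ->
  qj (quat_of b) * qk (quat_of c) = qk (quat_of b) * qj (quat_of c) ->
  exists g, [/\ (g * su2_i * g^-1)%g = su2_i,
    qk (quat_of (g * b * g^-1)%g) = 0 & qk (quat_of (g * c * g^-1)%g) = 0].
Proof.
rewrite /traceless.
case Eb : (quat_of b) => [[[b0 b1] b2] b3].
case Ec : (quat_of c) => [[[c0 c1] c2] c3].
rewrite /qre /qj /qk /= => b00 c00 bc.
have [t [tb tc]] : exists t,
    cos t * b3 + sin t * b2 = 0 /\ cos t * c3 + sin t * c2 = 0.
  (* t is minus the argument of the vector (y, x). *)
  have unit2 x y : (x, y) != 0 -> exists t, cos t * x + sin t * y = 0 /\
      forall x' y', y * x' = x * y' -> cos t * x' + sin t * y' = 0.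
    move=> xy; have n0 : 0 < x ^+ 2 + y ^+ 2.
      rewrite lt_neqAle addr_ge0 ?sqr_ge0// andbT eq_sym paddr_eq0 ?sqr_ge0//.
      by rewrite !sqrf_eq0 -xpair_eqE.
    pose s : R := Num.sqrt (x ^+ 2 + y ^+ 2).
    have s2 : s ^+ 2 = x ^+ 2 + y ^+ 2 by rewrite sqr_sqrtr// ltW.
    have s0 : s != 0 by rewrite gt_eqF// sqrtr_gt0.
    have [t [tc ts]] : exists t, y / s = cos t /\ - x / s = sin t.
      apply: polar; rewrite !exprMn exprVn s2 sqrrN -mulrDl addrC divff//.
      by rewrite -s2 expf_neq0.
    exists t; rewrite -tc -ts; split=> [|x' y' h]; first by field.
    by rewrite mulrAC h; field.
  have [b_eq0|/unit2[t [tb tbc]]] := eqVneq (b3, b2) 0; last first.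
    by exists t; split; [|apply: tbc].
  case: b_eq0 bc => -> -> _.
  have [c_eq0|/unit2[t [tc _]]] := eqVneq (c3, c2) 0; last first.
    by exists t; split; [ring|].
  by exists 0; case: c_eq0 => -> ->; split; ring.
pose p : R := cos (t / 2); pose q : R := sin (t / 2).
have pq : p ^+ 2 + q ^+ 2 = 1 by exact: cos2Dsin2.
have tE : t = (t / 2) *+ 2 by rewrite -mulr_natr; field.
have cE : cos t = p ^+ 2 - q ^+ 2.
  by rewrite tE cos_mulr2n -/p; nra.
have sE : sin t = 2 * p * q by rewrite tE sin_mulr2n -/p -/q; nra.
have u : unit_quat ((p, q, 0, 0) : quat R).
  rewrite /unit_quat /qnorm2 /qre /qi /qj /qk /=; nra.
move: tb tc; rewrite cE sE => tb tc.
have [|g [gE gi]] := @intertwine _ su2_i su2_i u.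
  rewrite quat_of_i.
  by rewrite /qmul /qre /qi /qj /qk /=; congr (_, _, _, _); ring.
exists g; split=> //.
- by rewrite !quat_ofM quat_ofV Eb gE -[RHS]tb b00;
    rewrite /qmul /qconj /qre /qi /qj /qk /=; ring.
- by rewrite !quat_ofM quat_ofV Ec gE -[RHS]tc c00;
    rewrite /qmul /qconj /qre /qi /qj /qk /=; ring.
Qed.

Lemma flat_polar a : traceless a -> qk (quat_of a) = 0 ->
  exists t, a = (su2_expk t * su2_i)%g.
Proof.
move=> ta ka; have := quat_ofP a; move: ta ka; rewrite /traceless.
case E : (quat_of a) => [[[a0 a1] a2] a3].
rewrite /unit_quat /qnorm2 /qre /qi /qj /qk /=.
move=> a00 a30 na.
have [t [c s]] : exists t, a1 = cos t /\ a2 = sin t.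
  by apply: polar; rewrite -na a00 a30; ring.
by exists t; apply: quat_of_inj; rewrite quat_expki E a00 a30 c s.
Qed.

Lemma sphere_rep_conj (rho : {ptws puncture -> SU2 R}) g :
  sphere_rep rho -> sphere_rep (fun p => g * rho p * g^-1 : SU2 R)%g.
Proof.
move=> [h t]; split=> [|p]; last exact: traceless_conj.
by transitivity (g * ev rho [:: Gen pb; Gen pa] * g^-1)%g;
  [exact: ev_conjugate | rewrite h; apply/esym; exact: ev_conjugate].
Qed.

Lemma sphere_relE (rho : puncture -> SU2 R) :
  ev rho [:: Gen pb; Gen pa] = ev rho [:: Gen pc; Gen pd] <->
  (rho pb * rho pa = rho pc * rho pd)%g.
Proof. by rewrite !ev_cons !ev_nil /= !mulg1. Qed.

(** As d is determined by a, b and c, its being traceless is a constraint on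
these three: they are coplanar, and their plane goes to that of i and j. *)
Lemma sphere_rep_pillow (rho : {ptws puncture -> SU2 R}) :
  sphere_rep rho -> exists v, conjugate rho (pillow_rep v).
Proof.
move=> rrho; have [g1 ga] := conj_to_i (rrho.2 pa).
have [rho1 [r1 c1 a1]] : exists rho1 : {ptws puncture -> SU2 R},
    [/\ sphere_rep rho1, conjugate rho rho1 & rho1 pa = su2_i].
  exists (fun p => g1 * rho p * g1^-1)%g; split=> //; last by exists g1.
  exact: sphere_rep_conj.
have [g2 [ia2 kb2 kc2]] : exists g, [/\ (g * su2_i * g^-1)%g = su2_i,
    qk (quat_of (g * rho1 pb * g^-1)%g) = 0 &
    qk (quat_of (g * rho1 pc * g^-1)%g) = 0].
  have [/sphere_relE rel t] := r1.
  (* The triple product of a, b, c is the real part of c b a = - d. *)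
  apply: flatten; [exact: t|exact: t|].
  have : rho1 pd = ((rho1 pc)^-1 * (rho1 pb * rho1 pa))%g by rewrite rel mulKg.
  move: (t pd) (t pb) (t pc) => /[swap] tb /[swap] tc /[swap] ->; move: tb tc.
  rewrite /traceless !quat_ofM quat_ofV a1 quat_of_i.
  case: (quat_of (rho1 pb)) => [[[b0 b1] b2] b3].
  case: (quat_of (rho1 pc)) => [[[c0 d1] c2] c3].
  rewrite /qmul /qconj /qre /qi /qj /qk /= => -> ->; lra.
have [rho2 [r2 c2 E2]] : exists rho2 : {ptws puncture -> SU2 R},
    [/\ sphere_rep rho2, conjugate rho1 rho2 &
        forall p, rho2 p = (g2 * rho1 p * g2^-1)%g].
  exists (fun p => g2 * rho1 p * g2^-1)%g; split=> //; last by exists g2.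
  exact: sphere_rep_conj.
have [/sphere_relE rel t] := r2.
rewrite -E2 in kb2; rewrite -E2 in kc2.
have [gam bE] := flat_polar (t pb) kb2; have [th cE] := flat_polar (t pc) kc2.
have aE : rho2 pa = su2_i by rewrite E2 a1.
exists (gam, th); apply: conjugate_trans c1 _; apply: conjugate_trans c2 _.
have [/sphere_relE rel' _] := pillow_rep_sphere (gam, th).
suff -> : rho2 = pillow_rep (gam, th) by exact: conjugate_refl.
apply/funext => -[]; [exact: aE|exact: bE|exact: cE|].
apply: (can_inj (mulKg (rho2 pc))); rewrite -rel cE.
by rewrite -[RHS]rel' aE bE.
Qed.

End Conjugation.

(** * Representations of the perturbed cylinder *)

Section Cylinder.
Context {R : realType}.
Implicit Types (f : R -> R) (Q : quat R) (g : SU2 R) (v : R * R).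

Section OddPeriodic.
Variable f : R -> R.
Hypothesis f_odd : forall x, f (- x) = - f x.
Hypothesis f_periodic : forall x, f (x + 2 * pi) = f x.

Lemma odd_periodic_cos_sin x y : cos x = cos y -> sin x = sin y -> f x = f y.
Proof.
by move=> cxy sxy; have [n ->] := cos_sin_inj cxy sxy; exact: periodic_int.
Qed.

(** If sin x = 0 then x and - x are congruent modulo 2 pi. *)
Lemma odd_periodic0 x : sin x = 0 -> f x = 0.
Proof.
move=> s0; have : f (- x) = f x.
  by apply: odd_periodic_cos_sin; rewrite ?cosN// sinN s0 oppr0.
rewrite f_odd; lra.
Qed.

(** Apart from e^{x Q} = 1 or - 1, two exponential forms of a unit quaternion
differ by a multiple of 2 pi in the angle or by (x, Q) -> (- x, - Q), which f
respects; in the exceptional cases f is 0 at both angles. *)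
Lemma qexp_odd_periodic x y Q Q' :
  pure_unit_quat Q -> pure_unit_quat Q' ->
  qexp x Q = qexp y Q' -> qexp (f x) Q = qexp (f y) Q'.
Proof.
move=> [Q0 _] [Q'0 _]; rewrite /qexp Q0 Q'0 !mulr0 !addr0 => -[cxy si sj sk].
have : sin x ^+ 2 == sin y ^+ 2 by rewrite !sin2cos2 cxy.
have [sy0|sy0] := eqVneq (sin y) 0.
  move=> /eqP; rewrite sy0 expr0n /= => /eqP; rewrite sqrf_eq0 => /eqP sx0.
  by rewrite !odd_periodic0// cos0 sin0 !mul0r.
rewrite eqf_sqr => /orP[]/eqP sxy.
  move: si sj sk; rewrite (odd_periodic_cos_sin cxy sxy) sxy.
  by move=> /(mulfI sy0)-> /(mulfI sy0)-> /(mulfI sy0)->.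
have -> : f x = - f y.
  by rewrite -f_odd; apply: odd_periodic_cos_sin; rewrite ?cosN ?sinN.
move: si sj sk; rewrite sxy !mulNr -!mulrN cosN sinN.
by move=> /(mulfI sy0)<- /(mulfI sy0)<- /(mulfI sy0)<-; rewrite !mulNr !mulrN.
Qed.
End OddPeriodic.

Lemma qexp_conj g (t : R) Q : pure_unit_quat Q ->
  qmul (qmul (quat_of g) (qexp t Q)) (qconj (quat_of g))
  = qexp t (qmul (qmul (quat_of g) Q) (qconj (quat_of g))).
Proof.
move=> [Q0 _]; have := quat_ofP g; rewrite /unit_quat /qnorm2 /=.
case: Q Q0 => [[[q0 q1] q2] q3]; case: (quat_of g) => [[[a b] c] d].
rewrite /qmul /qconj /qexp /qre /qi /qj /qk /= => -> n.
have a2 : a ^+ 2 = 1 - b ^+ 2 - c ^+ 2 - d ^+ 2 by rewrite -n; ring.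
by congr (_, _, _, _); ring: a2.
Qed.

Lemma pure_unit_quat_conj g Q : pure_unit_quat Q ->
  pure_unit_quat (qmul (qmul (quat_of g) Q) (qconj (quat_of g))).
Proof.
move=> [Q0 nQ]; split.
  move: Q0 {nQ}; case: Q => [[[q0 q1] q2] q3].
  case: (quat_of g) => [[[a b] c] d].
  by rewrite /qmul /qconj /qre /qi /qj /qk /= => ->; ring.
by rewrite !qnorm2M qnorm2_conj nQ (quat_ofP g) !mulr1.
Qed.

Lemma qexp_k (t : R) : qexp t quat_k = quat_of (su2_expk t).
Proof. by []. Qed.

(** The product ba is e^{(v.1 + pi) k}, and this fixes the value on mu_E. *)
Definition cyl_pillow_rep f (v : R * R) : {ptws cyl_gen -> SU2 R} := fun x =>
  match x with
  | Mer p => pillow_rep v p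
  | MuE => su2_expk (f (v.1 + pi))
  end.

Lemma cyl_pillow_lambdaE f v :
  ev (cyl_pillow_rep f v) lambdaE = su2_expk (v.1 + pi).
Proof. by rewrite /lambdaE !ev_cons ev_nil /= mulg1 expki_i. Qed.

Lemma cyl_pillow_rep_cyl f v :
  (forall x, f (- x) = - f x) -> (forall x, f (x + 2 * pi) = f x) ->
  cyl_rep f (cyl_pillow_rep f v).
Proof.
move=> fo fp; have [rel t] := pillow_rep_sphere v; split.
- by move: rel; rewrite !ev_cons !ev_nil.
- rewrite /lambdaE !ev_cons !ev_nil /= !mulg1 [RHS]mulgA.
  by rewrite expki_i !expkD addrC.
- by move=> p; exact: t.
- move=> alpha Q pQ; rewrite cyl_pillow_lambdaE -!qexp_k => h.
  exact: (qexp_odd_periodic fo fp pure_unit_quat_k pQ h).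
Qed.

(** A conjugation known on the meridians of the punctures carries ba to ba, so
by the perturbation condition it carries mu_E to mu_E. *)
Lemma cyl_rep_conj_pillow f (sigma : {ptws cyl_gen -> SU2 R}) v g :
  cyl_rep f sigma ->
  (forall p, sigma (Mer p) = (g * pillow_rep v p * g^-1)%g) ->
  forall x, sigma x = (g * cyl_pillow_rep f v x * g^-1)%g.
Proof.
move=> [_ _ _ hmu] hg; case=> [p|]; first exact: hg.
have lam : ev sigma lambdaE = (g * su2_expk (v.1 + pi) * g^-1)%g.
  by rewrite -expki_i /lambdaE !ev_cons ev_nil /= mulg1 !hg /= !mulgA mulgVK.
apply: quat_of_inj.
have := hmu (v.1 + pi) _ (pure_unit_quat_conj g pure_unit_quat_k).
rewrite -!(qexp_conj g _ pure_unit_quat_k) !qexp_k lam.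
by rewrite !quat_ofM !quat_ofV; apply.
Qed.

Lemma cyl_rep_pillow f (rho : {ptws cyl_gen -> SU2 R}) : cyl_rep f rho ->
  exists v, conjugate (cyl_pillow_rep f v) rho.
Proof.
move=> rrho.
have [v /conjugate_sym[g hg]] := sphere_rep_pillow (incl0_rep rrho).
exists v, g; apply: cyl_rep_conj_pillow => // p.
by rewrite -hg /pullback /incl0 ev_cons ev_nil mulg1.
Qed.

End Cylinder.

(** * The pillowcase as a character variety *)

Section Topology.
Context {R : realType}.

Lemma continuous_quat_of : continuous (@quat_of R).
Proof. exact: (@initial_continuous _ (quat R) set_val). Qed.

Lemma continuous_su2 (X : topologicalType) (F : X -> SU2 R) :
  continuous (fun x => quat_of (F x)) -> continuous F.
Proof.
by move=> cF; apply: (@continuous_comp_initial _ X (quat R) set_val).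
Qed.

Lemma continuous_cos_sin (X : topologicalType) (t : X -> R) : continuous t ->
  continuous (fun x => cos (t x)) /\ continuous (fun x => sin (t x)).
Proof.
move=> ct; split=> x; (apply: continuous_comp; first exact: ct).
  exact: continuous_cos.
exact: continuous_sin.
Qed.

Lemma continuous_expk (X : topologicalType) (t : X -> R) :
  continuous t -> continuous (fun x => su2_expk (t x)).
Proof.
move=> /continuous_cos_sin[ccos csin]; apply: continuous_su2.
rewrite (_ : (fun x => _) = fun x => (cos (t x), 0, 0, sin (t x))); last first.
  by apply/funext => x; rewrite quat_of_expk.
have c0 : continuous (fun _ : X => 0 : R) by move=> x; exact: cvg_cst.
by do !apply: continuous_prod.
Qed.

Lemma continuous_expki (X : topologicalType) (t : X -> R) :
  continuous t -> continuous (fun x => su2_expk (t x) * su2_i : SU2 R)%g.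
Proof.
move=> /continuous_cos_sin[ccos csin]; apply: continuous_su2.
rewrite (_ : (fun x => _) = fun x => (0, cos (t x), sin (t x), 0)); last first.
  by apply/funext => x; rewrite quat_expki.
have c0 : continuous (fun _ : X => 0 : R) by move=> x; exact: cvg_cst.
by do !apply: continuous_prod.
Qed.

Lemma continuous_class_of (X : topologicalType) (Y : Type)
    (A : set {ptws Y -> SU2 R}) (F : X -> {ptws Y -> SU2 R})
    (h : forall x, A (F x)) :
  (forall y, continuous (fun x => F x y)) ->
  continuous (fun x => class_of (rep_at (h x))).
Proof.
move=> cF.
have cr : continuous (fun x => rep_at (h x)).
  apply: (@continuous_comp_initial _ X _ set_val).
  exact: (@continuous_ptws _ X (fun _ : Y => SU2 R) F cF).
move=> x.
apply: (@continuous_comp _ _ _ (fun x => rep_at (h x)) (@class_of R Y A)).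
  exact: cr.
exact: pi_continuous.
Qed.

Lemma continuous_rep_eval (Y : eqType) (A : set {ptws Y -> SU2 R}) (y : Y) :
  continuous (fun r : set_type A => (\val r : {ptws Y -> SU2 R}) y).
Proof.
suff : continuous (@proj Y (fun _ => SU2 R) y \o (set_val : set_type A -> _)).
  exact.
move=> r; apply: continuous_comp; first exact: initial_continuous.
exact: proj_continuous.
Qed.

Lemma continuous_pillow_rep p : continuous (fun v : R * R => pillow_rep v p).
Proof.
case: p => /=; first by move=> v; exact: cvg_cst.
- by apply: continuous_expki => v; exact: cvg_fst.
- by apply: continuous_expki => v; exact: cvg_snd.
- by apply: continuous_expki => v; apply: cvgB; [exact: cvg_snd|exact: cvg_fst].
Qed.

Lemma continuous_cyl_pillow_rep (f : R -> R) x : continuous f ->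
  continuous (fun v : R * R => cyl_pillow_rep f v x).
Proof.
move=> cf; case: x => [p|] /=; first exact: continuous_pillow_rep.
apply: continuous_expk => v; apply: continuous_comp; last exact: cf.
by apply: cvgD; [exact: cvg_fst|exact: cvg_cst].
Qed.

Lemma continuous_from_pillow (Z : topologicalType) (h : pillowcase R -> Z) :
  continuous (h \o pillow) -> continuous h.
Proof. by move=> ch; exact/quotient_continuous. Qed.

Lemma continuous_pillow : continuous (@pillow R).
Proof. exact: pi_continuous. Qed.

Lemma pillowcase_compact : compact [set: pillowcase R].
Proof.
have -> : [set: pillowcase R] = pillow @` (`[0, 2 * pi] `*` `[0, 2 * pi]).
  apply/seteqP; split=> // x _.
  case: (pillow_repr x) (pillow_reprK x) => a b <-.
  have [m /andP[m0 m1]] := reduce_2pi a; have [n /andP[n0 n1]] := reduce_2pi b.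
  exists (a + m%:~R * (2 * pi), b + n%:~R * (2 * pi)); last exact: pillow_shift.
  by split; rewrite /= in_itv /= ?m0 ?n0 /= ltW.
apply: continuous_compact; last by apply: compact_setX; exact: segment_compact.
by apply: continuous_subspaceT; exact: continuous_pillow.
Qed.

Lemma continuous_qcoords : [/\ continuous (@qre R), continuous (@qi R),
  continuous (@qj R) & continuous (@qk R)].
Proof.
split=> q; last exact: cvg_snd.
- apply: (@continuous_comp _ _ _ (fun q : quat R => q.1.1) fst).
    by apply: continuous_comp; exact: cvg_fst.
  exact: cvg_fst.
- apply: (@continuous_comp _ _ _ (fun q : quat R => q.1.1) snd).
    by apply: continuous_comp; exact: cvg_fst.
  exact: cvg_snd.
- by apply: (@continuous_comp _ _ _ (fun q : quat R => q.1) snd);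
    [exact: cvg_fst|exact: cvg_snd].
Qed.

(** Half the traces of ab, ac and ad, hence class functions; in the coordinates
of the pillowcase they are the cosines of [pillow_cos], negated. *)
Definition trace_coords (rho : {ptws puncture -> SU2 R}) : R * R * R :=
  (qre (qmul (quat_of (rho pa)) (quat_of (rho pb))),
   qre (qmul (quat_of (rho pa)) (quat_of (rho pc))),
   qre (qmul (quat_of (rho pa)) (quat_of (rho pd)))).

Lemma qre_conj (x g : SU2 R) : qre (quat_of (g * x * g^-1)%g) = qre (quat_of x).
Proof.
have := quat_ofP g; rewrite !quat_ofM quat_ofV /unit_quat /qnorm2 /=.
case: (quat_of x) => [[[q0 q1] q2] q3]; case: (quat_of g) => [[[a b] c] d].
rewrite /qmul /qconj /qre /qi /qj /qk /= => n.
have a2 : a ^+ 2 = 1 - b ^+ 2 - c ^+ 2 - d ^+ 2 by rewrite -n; ring.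
by ring: a2.
Qed.

Lemma trace_coords_conj rho sigma : conjugate rho sigma ->
  trace_coords rho = trace_coords sigma.
Proof.
move=> [g h]; rewrite /trace_coords.
have E p q : qre (qmul (quat_of (rho p)) (quat_of (rho q)))
    = qre (qmul (quat_of (sigma p)) (quat_of (sigma q))).
  by rewrite -!quat_ofM !h -[LHS](qre_conj _ g) !mulgA mulgVK.
by rewrite !E.
Qed.

Lemma continuous_qre_mul (X : topologicalType) (F G : X -> quat R) :
  continuous F -> continuous G -> continuous (fun x => qre (qmul (F x) (G x))).
Proof.
move=> cF cG; have [c0 c1 c2 c3] := continuous_qcoords.
have cc (q : quat R -> R) (H : X -> quat R) :
    continuous q -> continuous H -> continuous (fun x => q (H x)).
  by move=> cq cH x; apply: continuous_comp; [exact: cH|exact: cq].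
have : continuous (fun x => qre (F x) * qre (G x) - qi (F x) * qi (G x)
    - qj (F x) * qj (G x) - qk (F x) * qk (G x)).
  move=> x; do 3?apply: cvgB; apply: cvgM.
  - exact: (cc _ _ c0 cF).
  - exact: (cc _ _ c0 cG).
  - exact: (cc _ _ c1 cF).
  - exact: (cc _ _ c1 cG).
  - exact: (cc _ _ c2 cF).
  - exact: (cc _ _ c2 cG).
  - exact: (cc _ _ c3 cF).
  - exact: (cc _ _ c3 cG).
exact.
Qed.

Lemma continuous_trace_coords : continuous trace_coords.
Proof.
have cp p : continuous (fun rho : {ptws puncture -> SU2 R} => quat_of (rho p)).
  move=> rho; apply: continuous_comp; last exact: continuous_quat_of.
  exact: (@proj_continuous puncture (fun _ => SU2 R) p).
have cE p q := continuous_qre_mul (cp p) (cp q).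
by do !apply: continuous_prod.
Qed.

Definition trace_class (x : R_sphere R) : R * R * R :=
  trace_coords (\val (rep_of x)).

Lemma trace_classE (r : set_type (@sphere_rep R)) :
  trace_class (class_of r) = trace_coords (\val r).
Proof.
by apply: trace_coords_conj; apply/class_ofP; exact: rep_ofK.
Qed.

Lemma continuous_trace_class : continuous trace_class.
Proof.
apply/quotient_continuous.
rewrite (_ : _ \o _ = trace_coords \o set_val); last first.
  by apply/funext => r; exact: trace_classE.
move=> r; apply: continuous_comp; last exact: continuous_trace_coords.
exact: initial_continuous.
Qed.

Lemma trace_pillow_iso v :
  trace_class (pillow_iso (pillow v)) =
  (- cos v.1, - cos v.2, - cos (v.2 - v.1)).
Proof.
rewrite pillow_isoE trace_classE /trace_coords /= !quat_expki quat_of_i.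
by rewrite /qmul /qre /qi /qj /qk /=; congr (_, _, _); ring.
Qed.

Lemma trace_pillow_iso_inj : injective (trace_class \o @pillow_iso R).
Proof.
move=> x y; rewrite -(pillow_reprK x) -(pillow_reprK y) /=.
case: (pillow_repr x) => a b; case: (pillow_repr y) => a' b'.
rewrite !trace_pillow_iso /= => -[/oppr_inj ? /oppr_inj ? /oppr_inj ?].
exact: pillow_cos.
Qed.

Lemma continuous_pillow_iso : continuous (@pillow_iso R).
Proof.
apply: continuous_from_pillow.
rewrite (_ : _ \o _ = fun v => class_of (rep_at (pillow_rep_sphere v))).
  by apply: continuous_class_of => p; exact: continuous_pillow_rep.
by apply/funext => v; exact: pillow_isoE.
Qed.

Lemma R3_hausdorff : hausdorff_space (R * R * R)%type.
Proof. exact: (@norm_hausdorff _ (R * R * R)%type). Qed.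

Lemma pillow_iso_homeo : homeomorphism (@pillow_iso R).
Proof.
apply: (compact_homeomorphism pillowcase_compact R3_hausdorff
  continuous_pillow_iso continuous_trace_class trace_pillow_iso_inj) => y.
have [v /conjugate_sym c] := sphere_rep_pillow (rep_atP (rep_of y)).
exists (pillow v); rewrite pillow_isoE -(rep_ofK y); exact/class_ofP.
Qed.

End Topology.

(** * Smoothness of shears of the plane *)

Section Smooth.
Context {R : realType}.

Lemma diff_shear (p q c s k l : R) (h : R -> R) (u v : R * R) :
  derivable h (u.1 + s) 1 ->
  let g := fun w : R * R => (p * w.1 + k, q * w.2 + c * h (w.1 + s) + l) in
  differentiable g u /\
  'D_v g u = (p * v.1, q * v.2 + c * (v.1 * derive1 h (u.1 + s))).
Proof.
move=> dh g.
have d1 : is_diff u (fst : R * R -> R) fst.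
  by apply: DiffDef; [exact: linear_differentiable (fun x => cvg_fst)
                     |exact: diff_lin (fun x => cvg_fst)].
have d2 : is_diff u (snd : R * R -> R) snd.
  by apply: DiffDef; [exact: linear_differentiable (fun x => cvg_snd)
                     |exact: diff_lin (fun x => cvg_snd)].
have dh' : is_diff (u.1 + s) h (fun x => x * derive1 h (u.1 + s)).
  apply: DiffDef; first exact/derivable1_diffP.
  by rewrite diff1E//; exact/derivable1_diffP.
have d3 : is_diff u (fun w : R * R => w.1 + s) fst.
  by have := is_diffD d1 (is_diff_cst s u); rewrite addr0.
have d4 : is_diff u (fun w : R * R => h (w.1 + s))
    (fun w => w.1 * derive1 h (u.1 + s)).
  exact: (is_diff_comp d3 dh').
have e1 := is_diffD (is_diffZ p d1) (is_diff_cst k u).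
have e2 :=
  is_diffD (is_diffD (is_diffZ q d2) (is_diffZ c d4)) (is_diff_cst l u).
have dg := is_diff_pair e1 e2.
have -> : g = fun y => ((p *: fst + cst k) y,
  (q *: snd + c *: (fun w => h (w.1 + s)) + cst l) y) by [].
split; first exact: ex_diff.
rewrite deriveE; last exact: ex_diff.
by rewrite diff_val !fctE addr0 addr0.
Qed.

(** The derivative along v has the same form, with c v.1 for c, the derivative
of h for h, and constants p v.1 and q v.2 in place of the terms linear in w.
The affine terms are there to make the induction on n close. *)
Lemma Cn_shear n (p q c s k l : R) (h : R -> R) :
  (forall n x, derivable (h^`(n)) x 1) ->
  Cn_on n [set: R * R]
    (fun w : R * R => (p * w.1 + k, q * w.2 + c * h (w.1 + s) + l)).
Proof.
elim: n p q c k l h => [|n IH] p q c k l h sh.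
  move=> u _; apply: differentiable_continuous.
  by have [] := diff_shear p q c k l u (sh 0%N (u.1 + s)).
split=> [u _|v]; first by have [] := diff_shear p q c k l u (sh 0%N (u.1 + s)).
rewrite (_ : 'D_v _ =
    fun w => (0 * w.1 + p * v.1,
      0 * w.2 + (c * v.1) * derive1 h (w.1 + s) + q * v.2)).
  by apply: IH => m x; rewrite -derive1Sn; exact: sh.
apply/funext => u; rewrite (diff_shear p q c k l v (sh 0%N (u.1 + s))).2.
by congr (_, _); ring.
Qed.
End Smooth.

(** * The shear of the pillowcase *)

Section Shear.
Context {R : realType}.

Definition shear (f : R -> R) (v : R * R) : R * R :=
  (v.1, v.2 + 2 * f (v.1 + pi)).

Lemma continuous_shear f : continuous f -> continuous (shear f).
Proof.
move=> cf; apply: continuous_prod => v; first exact: cvg_fst.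
apply: cvgD; first exact: cvg_snd.
apply: cvgM; first exact: cvg_cst.
apply: continuous_comp; last exact: cf.
by apply: cvgD; [exact: cvg_fst|exact: cvg_cst].
Qed.

Section OddPeriodic.
Variable f : R -> R.
Hypothesis f_odd : forall x, f (- x) = - f x.
Hypothesis f_periodic : forall x, f (x + 2 * pi) = f x.

Lemma shear_pillow_group g v : pillow_group g ->
  pillow (shear f (g v)) = pillow (shear f v).
Proof.
move=> pg; elim: pg v => {g} [||||g h _ IHg _ IHh|g h _ IHg gK hK] v //=.
- have := pillow_shift 1 0 v.1 (v.2 + 2 * f (v.1 + pi)).
  by rewrite mul0r addr0 mul1r /shear /= addrAC f_periodic.
- have := pillow_shift 0 1 v.1 (v.2 + 2 * f (v.1 + pi)).
  by rewrite mul0r addr0 mul1r /shear /= addrAC.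
- have -> : shear f (- v.1, - v.2) = (- v.1, - (v.2 + 2 * f (v.1 + pi))).
    rewrite /shear /=; congr (_, _).
    rewrite (_ : - v.1 + pi = - (v.1 + pi) + 2 * pi); last by ring.
    by rewrite f_periodic f_odd; ring.
  exact: pillowN.
- by rewrite IHg IHh.
- by rewrite -[in RHS](hK v) IHg.
Qed.

Lemma c_deltaE v : c_delta f (pillow v) = pillow (shear f v).
Proof.
rewrite -[LHS]/(pillow (shear f (pillow_repr (pillow v)))).
have /pillowP[g pg gE] := pillow_reprK (pillow v).
by rewrite -{2}gE shear_pillow_group.
Qed.

Lemma continuous_c_delta : continuous f -> continuous (c_delta f).
Proof.
move=> cf; apply: continuous_from_pillow.
rewrite (_ : _ \o _ = pillow \o shear f); last first.
  by apply/funext => v; exact: c_deltaE.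
move=> v; apply: continuous_comp; last exact: continuous_pillow.
exact: continuous_shear.
Qed.
End OddPeriodic.

Lemma c_delta_opp (f : R -> R) : (forall x, f (- x) = - f x) ->
  (forall x, f (x + 2 * pi) = f x) ->
  cancel (c_delta f) (c_delta (fun x => - f x)).
Proof.
move=> fo fp x; rewrite -(pillow_reprK x) !c_deltaE//.
- by rewrite /shear /= mulrN addrK; case: (pillow_repr x).
- by move=> t; rewrite fo.
- by move=> t; rewrite fp.
Qed.

Lemma c_delta_homeo (f : R -> R) : (forall x, f (- x) = - f x) ->
  (forall x, f (x + 2 * pi) = f x) -> continuous f ->
  homeomorphism (c_delta f).
Proof.
move=> fo fp cf.
have go x : - f (- x) = - - f x by rewrite fo.
have gp x : - f (x + 2 * pi) = - f x by rewrite fp.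
split; first exact: continuous_c_delta.
exists (c_delta (fun x => - f x)).
  by apply: continuous_c_delta => // x; apply: cvgN; exact: cf.
split; first exact: c_delta_opp.
have {2}-> : f = (fun x => - - f x) by apply/funext => x; rewrite opprK.
exact: c_delta_opp.
Qed.

(** The homeomorphism property, unlike continuity alone, passes to inverses, as
the last constructor of the group demands. *)
Lemma pillow_group_homeo (g : R * R -> R * R) :
  pillow_group g -> homeomorphism g.
Proof.
have ctrans (a : R) : continuous (fun v : R * R => (v.1 + a, v.2)) /\
    continuous (fun v : R * R => (v.1, v.2 + a)).
  split; apply: continuous_prod => v.
  - by apply: cvgD; [exact: cvg_fst|exact: cvg_cst].
  - exact: cvg_snd.
  - exact: cvg_fst.
  - by apply: cvgD; [exact: cvg_snd|exact: cvg_cst].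
elim=> {g} [||||g h _ IHg _ IHh|g h _ [cg [g' cg' [gK' g'K]]] gK hK].
- split; first exact: (ctrans (2 * pi)).1.
  exists (fun v => (v.1 - 2 * pi, v.2)); first exact: (ctrans (- (2 * pi))).1.
  by split=> -[x y] /=; rewrite ?addrK ?subrK.
- split; first exact: (ctrans (2 * pi)).2.
  exists (fun v => (v.1, v.2 - 2 * pi)); first exact: (ctrans (- (2 * pi))).2.
  by split=> -[x y] /=; rewrite ?addrK ?subrK.
- have c : continuous (fun v : R * R => (- v.1, - v.2)).
    apply: continuous_prod => v; apply: cvgN; [exact: cvg_fst|exact: cvg_snd].
  split=> //; exists (fun v => (- v.1, - v.2)) => //.
  by split=> -[x y] /=; rewrite !opprK.
- by split=> [v|]; [exact: cvg_id|exists id => // v; exact: cvg_id].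
- exact: homeo_comp.
- have -> : h = g' by apply/funext => v; rewrite -[RHS](gK) g'K.
  by split=> //; exists g.
Qed.

(** The saturation of U is the union of its images under a group of
homeomorphisms of the plane. *)
Lemma pillow_open (U : set (R * R)) : open U -> open (pillow @` U).
Proof.
move=> oU; rewrite -[open _]/(open (pillow @^-1` (pillow @` U))).
rewrite openE => w [u Uu /esym/pillowP[g pg gw]].
have [cg _] := pillow_group_homeo pg.
apply: (@filterS _ _ _ (g @^-1` U)); last first.
  by apply: cg; rewrite gw; exact: open_nbhs_nbhs.
by move=> z Ugz; exists (g z) => //; apply/esym/pillowP; exists g.
Qed.

(** Continuity on the product with the time line cannot be read from the
quotient topology directly; the product of the identity with the projection is
a quotient map as the projection is open. *)
Lemma continuous_c_delta_family (f : R -> R) : (forall x, f (- x) = - f x) ->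
  (forall x, f (x + 2 * pi) = f x) -> continuous f ->
  continuous (fun tx : R * pillowcase R => c_delta (fun s => tx.1 * f s) tx.2).
Proof.
move=> fo fp cf.
have E (t : R) v : c_delta (fun s => t * f s) (pillow v) =
    pillow (shear (fun s => t * f s) v).
  by apply: c_deltaE => x; rewrite ?fo ?fp ?mulrN.
pose G (tv : R * (R * R)) := pillow (shear (fun s => tv.1 * f s) tv.2).
have cG : continuous G.
  have c1 : continuous (fun tv : R * (R * R) => tv.2.1).
    by move=> tv; apply: continuous_comp; [exact: cvg_snd|exact: cvg_fst].
  have c2 : continuous (fun tv : R * (R * R) => tv.2.2).
    by move=> tv; apply: continuous_comp; [exact: cvg_snd|exact: cvg_snd].
  have c3 : continuous (fun tv : R * (R * R) => f (tv.2.1 + pi)).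
    move=> tv; apply: continuous_comp; last exact: cf.
    by apply: cvgD; [exact: c1|exact: cvg_cst].
  have c4 : continuous (fun tv : R * (R * R) =>
      shear (fun s => tv.1 * f s) tv.2).
    apply: continuous_prod => // tv; apply: cvgD; first exact: c2.
    apply: cvgM; first exact: cvg_cst.
    by apply: cvgM; [exact: cvg_fst|exact: c3].
  by move=> tv; apply: continuous_comp; [exact: c4|exact: continuous_pillow].
move=> [t x] A; rewrite /= -(pillow_reprK x) E => nA.
have /(cG (t, pillow_repr x)) [[B1 B2] [/= nB1 nB2] sub] :
  nbhs (G (t, pillow_repr x)) A by [].
exists (B1, pillow @` B2°) => /=.
  split=> //; apply: open_nbhs_nbhs; split.
    by apply: pillow_open; exact: open_interior.
  by exists (pillow_repr x).
move=> [s y] /= [B1s [v B2v <-]]; rewrite E.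
by apply: (sub (s, v)); split=> //; exact: interior_subset.
Qed.

Lemma pillow_corner_invariant g v : pillow_group g ->
  pillow_corner (g v) -> pillow_corner (v : R * R).
Proof.
have : pillow_group g -> forall v, pillow_corner v <-> pillow_corner (g v).
  elim=> {g v} [||||g h _ IHg _ IHh|g h _ IHg gK hK] v.
  - split=> [[m [n ->]]|[m [n [v1 v2]]]].
      by exists (m + 2), n; congr (_, _) => /=; ring.
    by exists (m - 2), n; case: v v1 v2 => x y /= v1 ->; congr (_, _);
      rewrite -(addrK (2 * pi) x) v1; ring.
  - split=> [[m [n ->]]|[m [n [v1 v2]]]].
      by exists m, (n + 2); congr (_, _) => /=; ring.
    by exists m, (n - 2); case: v v1 v2 => x y /= -> v2; congr (_, _);
      rewrite -(addrK (2 * pi) y) v2; ring.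
  - split=> [[m [n ->]]|[m [n [v1 v2]]]].
      by exists (- m), (- n); congr (_, _) => /=; ring.
    by exists (- m), (- n); case: v v1 v2 => x y /= v1 v2; congr (_, _);
      [rewrite -(opprK x) v1 | rewrite -(opprK y) v2]; ring.
  - by [].
  - by rewrite IHh IHg.
  - by rewrite (IHg (h v)) hK.
by move=> H /H/(_ v)[].
Qed.

Lemma sin_int_pi (m : int) : sin (m%:~R * pi) = 0 :> R.
Proof.
have := @periodic_int R bool (fun x => sin x == 0) pi _ m 0.
rewrite add0r sin0 eqxx => /(_ (fun x => _))/eqP; apply=> x.
by rewrite sinDpi oppr_eq0.
Qed.

(** Since f vanishes on pi Z, the shear moves a point to a corner only if that
point is itself a corner.  Its lift to the plane serves as a chart expression
at every point. *)
Lemma smooth_c_delta (f : R -> R) : (forall x, f (- x) = - f x) ->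
  (forall x, f (x + 2 * pi) = f x) ->
  (forall n x, derivable (f^`(n)) x 1) ->
  smooth_off_corners (c_delta f).
Proof.
move=> fo fp fs v nv; split.
  move=> w; rewrite c_deltaE// => /esym/pillowP[g pg gw] cw.
  apply: nv; have : pillow_corner (shear f v).
    by apply: (pillow_corner_invariant pg); rewrite gw.
  move=> [m [n [v1 v2]]]; exists m, n.
  have f0 : f (v.1 + pi) = 0.
    apply: odd_periodic0 => //; rewrite sinDpi.
    by move: v1 => /= ->; rewrite sin_int_pi oppr0.
  by move: v1 v2; rewrite /= f0 mulr0 addr0; case: v {cw f0 gw} => x y /= -> ->.
exists setT, (shear f); split=> //; first exact: openT.
  move=> n; rewrite (_ : shear f =
      fun w => (1 * w.1 + 0, 1 * w.2 + 2 * f (w.1 + pi) + 0)).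
    exact: Cn_shear.
  by apply/funext => w; rewrite /shear !mul1r !addr0.
by move=> u _; exact: c_deltaE.
Qed.
End Shear.

(** * The pillowcase as the perturbed character variety *)

Section CylIso.
Context {R : realType}.
Variable f : R -> R.
Hypothesis f_odd : forall x, f (- x) = - f x.
Hypothesis f_periodic : forall x, f (x + 2 * pi) = f x.

(** Up to the identification [pillow_iso], the inverse of [restr0]. *)
Definition cyl_iso (x : pillowcase R) : R_delta f :=
  class_of (rep_at (cyl_pillow_rep_cyl (pillow_repr x) f_odd f_periodic)).

Lemma restr0_class v :
  restr0 (class_of (rep_at (cyl_pillow_rep_cyl v f_odd f_periodic)))
  = pillow_iso (pillow v).
Proof.
rewrite pillow_isoE /restr0 restrictionE; apply/class_ofP => /=.
rewrite (_ : pullback _ _ = pillow_rep v); first exact: conjugate_refl.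
by apply/funext => p; rewrite /pullback /incl0 ev_cons ev_nil mulg1.
Qed.

Lemma restr1_class v :
  restr1 (class_of (rep_at (cyl_pillow_rep_cyl v f_odd f_periodic)))
  = pillow_iso (c_delta f (pillow v)).
Proof.
rewrite c_deltaE// pillow_isoE /restr1 restrictionE; apply/class_ofP => /=.
rewrite (_ : pullback _ _ = pillow_rep (shear f v)).
  exact: conjugate_refl.
apply/funext => -[]; rewrite /pullback /incl1 !ev_cons ev_nil /= ?mulg1 //.
  by rewrite mulgA expk_conj_expki.
by rewrite mulgA expk_conj_expki addrAC.
Qed.

Lemma cyl_isoE v :
  cyl_iso (pillow v) =
  class_of (rep_at (cyl_pillow_rep_cyl v f_odd f_periodic)).
Proof.
apply/class_ofP => /=.
set w := pillow_repr _.
have [g hg] : conjugate (pillow_rep w) (pillow_rep v).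
  have /pillowP[g pg <-] := pillow_reprK (pillow v).
  exact: pillow_rep_invariant.
by exists g; apply: cyl_rep_conj_pillow => //; exact: cyl_pillow_rep_cyl.
Qed.

Lemma continuous_cyl_iso : continuous f -> continuous cyl_iso.
Proof.
move=> cf; apply: continuous_from_pillow.
rewrite (_ : _ \o _ = fun v =>
  class_of (rep_at (cyl_pillow_rep_cyl v f_odd f_periodic))).
  by apply: continuous_class_of => x; exact: continuous_cyl_pillow_rep.
by apply/funext => v; exact: cyl_isoE.
Qed.

Lemma continuous_restr0 : continuous (@restr0 R f).
Proof.
apply/quotient_continuous.
rewrite (_ : _ \o _ = fun r => class_of (rep_at (incl0_rep (rep_atP r)))).
  apply: continuous_class_of => p.
  rewrite (_ : (fun r => _) = (fun r => \val r (Mer p))); last first.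
    by apply/funext => r; rewrite /pullback /incl0 ev_cons ev_nil mulg1.
  exact: continuous_rep_eval.
by apply/funext => r; exact: restrictionE.
Qed.

Lemma restr0_cyl_iso x : restr0 (cyl_iso x) = pillow_iso x.
Proof. by rewrite -(pillow_reprK x) cyl_isoE restr0_class. Qed.

Lemma restr1_cyl_iso x : restr1 (cyl_iso x) = pillow_iso (c_delta f x).
Proof. by rewrite -(pillow_reprK x) cyl_isoE restr1_class. Qed.

Lemma cyl_iso_homeo : continuous f -> homeomorphism cyl_iso.
Proof.
move=> cf.
apply: (@compact_homeomorphism _ _ _ _ (trace_class \o @restr0 R f)
  pillowcase_compact R3_hausdorff (continuous_cyl_iso cf)).
- move=> x; apply: continuous_comp; [exact: continuous_restr0|].
  exact: continuous_trace_class.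
- rewrite (_ : _ \o _ = trace_class \o pillow_iso).
    exact: trace_pillow_iso_inj.
  by apply/funext => x /=; rewrite restr0_cyl_iso.
- move=> y; have [v c] := cyl_rep_pillow (rep_atP (rep_of y)).
  exists (pillow v); rewrite cyl_isoE -(rep_ofK y); exact/class_ofP.
Qed.
End CylIso.

Theorem theorem9p1 (R : realType) (f : R -> R)
    (f_smooth : forall (n : nat) (x : R), derivable (f^`(n)) x 1)
    (f_odd : forall x : R, f (- x) = - f x)
    (f_periodic : forall x : R, f (x + 2 * pi) = f x) :
  [/\ homeomorphism (@restr0 R f) /\
      (exists Phi : pillowcase R -> R_delta f,
         [/\ homeomorphism Phi,
             forall x, restr0 (Phi x) = pillow_iso x &
             forall x, (restr0 (Phi x), restr1 (Phi x)) =
                       (pillow_iso x, pillow_iso (c_delta f x))]),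
      forall gamma theta : R,
        c_delta f (pillow (gamma, theta)) =
        pillow (gamma, theta + 2 * f (gamma + pi)),
      homeomorphism (c_delta f),
      smooth_off_corners (c_delta f) &
      isotopy (fun t : R => c_delta (fun s : R => t * f s)) id (c_delta f)].
Proof.
have cf : continuous f.
  move=> x; apply/differentiable_continuous/derivable1_diffP.
  exact: (f_smooth 0%N).
split.
- have [hPhi r0 r1] := And3 (cyl_iso_homeo f_odd f_periodic cf)
    (restr0_cyl_iso f_odd f_periodic) (restr1_cyl_iso f_odd f_periodic).
  split; last by exists (cyl_iso f_odd f_periodic); split=> // x; rewrite r0 r1.
  apply: (homeo_of_comp hPhi); rewrite (_ : _ \o _ = pillow_iso).
    exact: pillow_iso_homeo.
  by apply/funext => x; exact: r0.
- by move=> gamma theta; exact: c_deltaE.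
- exact: c_delta_homeo.
- exact: smooth_c_delta.
- split.
  + by apply: continuous_subspaceT; exact: continuous_c_delta_family.
  + move=> t _; apply: c_delta_homeo => x.
    * by rewrite f_odd mulrN.
    * by rewrite f_periodic.
    * by apply: cvgM; [exact: cvg_cst|exact: cf].
  + move=> x; rewrite -(pillow_reprK x) c_deltaE.
    * by rewrite /shear mul0r mulr0 addr0; case: (pillow_repr x).
    * by move=> t; rewrite !mul0r oppr0.
    * by move=> t; rewrite !mul0r.
  + by move=> x; congr c_delta; apply/funext => s; rewrite mul1r.
Qed.
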